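(* Let $(X,\delta)$ be an ordinal space with $|X|=n$, $n$ a positive integer, and suppose that $X$ is embeddable in $\mathbb R^1$. Then there exists an enumeration $x_1,x_2,\ldots,x_n$ of the points of $X$ satisfying the majorization property.
   Context: An ordinal space is an ordered triplet $(X,L,\delta)$, also written $(X,\delta)$, where $X$ is a set, $L$ is a linearly ordered set with minimal element $0$, and $\delta\colon X\times X\to L$ is a surjective mapping such that for all $x,y\in X$: (i) $\delta(x,y)=\delta(y,x)$; (ii) $\delta(x,y)=0$ if and only if $x=y$. $X$ is embeddable in $\mathbb R^m$ (written $X\hookrightarrow\mathbb R^m$) if there is a mapping $\Phi\colon X\to\mathbb R^m$ such that for all $x,y,z,w\in X$ the comparison ($<$, $=$ or $>$) of $\delta(x,y)$ with $\delta(z,w)$ is the same as that of the Euclidean distances $d(\Phi(x),\Phi(y))$ and $d(\Phi(z),\Phi(w))$. Majorization property: let $\mathcal I_n$ be the set of all finite sequences $(i_0,i_1,\ldots,i_k)\in\{1,\ldots,n\}^{k+1}$, $k\geqslant 1$, with $i_0\leqslant i_1\leqslant\ldots\leqslant i_k$. Given an enumeration $x_1,\ldots,x_n$ of the points of $X$ and two sequences $(i_0,\ldots,i_k),(j_0,\ldots,j_k)\in\mathcal I_n$ of the same length, write $(i_0,\ldots,i_k)\sim(j_0,\ldots,j_k)$ if there is a permutation $\pi$ of $\{1,\ldots,k\}$ with $\delta(x_{i_{l-1}},x_{i_l})=\delta(x_{j_{\pi(l)-1}},x_{j_{\pi(l)}})$ for all $l\in\{1,\ldots,k\}$; write $(i_0,\ldots,i_k)\prec(j_0,\ldots,j_k)$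 if there is a permutation $\pi$ of $\{1,\ldots,k\}$ with $\delta(x_{i_{l-1}},x_{i_l})\leqslant\delta(x_{j_{\pi(l)-1}},x_{j_{\pi(l)}})$ for all $l\in\{1,\ldots,k\}$, but not with equality for all $l$. The enumeration has the majorization property if for all $k\geqslant1$ and all $(i_0,\ldots,i_k),(j_0,\ldots,j_k)\in\mathcal I_n$: $(i_0,\ldots,i_k)\prec(j_0,\ldots,j_k)$ implies $\delta(x_{i_0},x_{i_k})<\delta(x_{j_0},x_{j_k})$, and $(i_0,\ldots,i_k)\sim(j_0,\ldots,j_k)$ implies $\delta(x_{i_0},x_{i_k})=\delta(x_{j_0},x_{j_k})$. *)

(* Defs.v *)
From mathcomp Require Import all_boot all_order all_algebra all_fingroup.
From mathcomp Require Import reals.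
Set Implicit Arguments.
Unset Strict Implicit.
Unset Printing Implicit Defensive.

Import Order.TTheory GRing.Theory Num.Theory.
Local Open Scope ring_scope.

(* The minimal element 0 of L is [\bot]. *)
Record ordinal_space (X : Type) (d : Order.disp_t) (L : bOrderType d)
    (delta : X -> X -> L) : Prop := OrdinalSpace {
  ordinal_space_surj : forall l : L, exists x y : X, delta x y = l;
  ordinal_space_sym : forall x y : X, delta x y = delta y x;
  ordinal_space_eq0 : forall x y : X, delta x y = \bot%O <-> x = y
}.

(* The norm that MathComp-Analysis puts on ['rV[R]_m] is the sup norm, hence
   this explicit Euclidean distance. *)
Definition euclidean_dist (R : realType) (m : nat) (u v : 'rV[R]_m) : R :=
  Num.sqrt (\sum_(i < m) (u 0 i - v 0 i) ^+ 2).

Definition embeddable (R : realType) (m : nat) (X : Type) (d : Order.disp_t)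
    (L : bOrderType d) (delta : X -> X -> L) : Prop :=
  exists Phi : X -> 'rV[R]_m, forall x y z w : X,
    let dxy := euclidean_dist (Phi x) (Phi y) in
    let dzw := euclidean_dist (Phi z) (Phi w) in
    [/\ (delta x y < delta z w)%O <-> dxy < dzw,
        delta x y = delta z w <-> dxy = dzw &
        (delta x y > delta z w)%O <-> dxy > dzw].

(* Points and sequences are indexed from 0: a sequence (i_0, ..., i_k) is a
   function ['I_k.+1 -> 'I_n]. For [l : 'I_k], [step_start l] and [step_end l]
   are the positions l and l + 1, i.e. the ends of the step that is numbered
   l + 1 when steps are indexed by {1, ..., k}. *)
Definition step_start (k : nat) (l : 'I_k) : 'I_k.+1 := widen_ord (leqnSn k) l.
Definition step_end (k : nat) (l : 'I_k) : 'I_k.+1 := lift ord0 l.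

Definition monotone_seq (n k : nat) (i : 'I_k.+1 -> 'I_n) : Prop :=
  forall l : 'I_k, (i (step_start l) <= i (step_end l))%N.

Section Majorization.
Variables (X : Type) (d : Order.disp_t) (L : bOrderType d).
Variables (delta : X -> X -> L) (n : nat) (x : 'I_n -> X).

Definition step_dist (k : nat) (i : 'I_k.+1 -> 'I_n) (l : 'I_k) : L :=
  delta (x (i (step_start l))) (x (i (step_end l))).

Definition end_dist (k : nat) (i : 'I_k.+1 -> 'I_n) : L :=
  delta (x (i ord0)) (x (i ord_max)).

Definition seq_sim (k : nat) (i j : 'I_k.+1 -> 'I_n) : Prop :=
  exists pi : 'S_k, forall l : 'I_k, step_dist i l = step_dist j (pi l).

Definition seq_prec (k : nat) (i j : 'I_k.+1 -> 'I_n) : Prop :=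
  exists pi : 'S_k,
    (forall l : 'I_k, (step_dist i l <= step_dist j (pi l))%O) /\
    ~ (forall l : 'I_k, step_dist i l = step_dist j (pi l)).

Definition majorization_property : Prop :=
  forall (k : nat) (i j : 'I_k.+1 -> 'I_n), (1 <= k)%N ->
    monotone_seq i -> monotone_seq j ->
    (seq_prec i j -> (end_dist i < end_dist j)%O) /\
    (seq_sim i j -> end_dist i = end_dist j).

End Majorization.

(* Main.v *)
Require Import Defs.
From mathcomp Require Import all_boot all_order all_algebra all_fingroup.
From mathcomp Require Import reals.
Set Implicit Arguments.
Unset Strict Implicit.
Unset Printing Implicit Defensive.

Import Order.TTheory GRing.Theory Num.Theory.
Local Open Scope ring_scope.

(** An embedding into the line amounts to a real coordinate [f] on [X] such
    that [delta x y] and [delta z w] compare as [`|f x - f y|] and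
    [`|f z - f w|] do.  Enumerate [X] by nondecreasing [f].  Along a monotone
    sequence of indices the coordinate then never decreases, so no triangle
    inequality is strict: the distance between the two ends is exactly the sum
    of the step distances ([dist_ends_sum]).  Majorization thus reduces to
    comparing two sums term by term, after permuting the terms of one of them;
    the sums compare strictly as soon as one pair of terms does. *)

Lemma euclidean_dist1 (R : realType) (u v : 'rV[R]_1) :
  euclidean_dist u v = `|u 0 0 - v 0 0|.
Proof. by rewrite /euclidean_dist big_ord1 sqrtr_sqr. Qed.

Lemma telescope_steps (V : zmodType) (k : nat) (g : 'I_k.+1 -> V) :
  \sum_(l < k) (g (step_end l) - g (step_start l)) = g ord_max - g ord0.
Proof.
(* [inord] extends [g] to all naturals, where the telescoping sum lives. *)
have -> : g ord_max - g ord0 = g (inord k) - g (inord 0).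
  by congr (g _ - g _); apply/val_inj; rewrite /= inordK.
rewrite -(telescope_sumr (fun m => g (inord m)) (leq0n k)) big_mkord.
apply: eq_bigr => l _.
by congr (g _ - g _); apply/val_inj; rewrite /= inordK // ltnS // ltnW.
Qed.

(** With [g] nondecreasing, every absolute value is a difference taken in the
    same direction, so the sum telescopes. *)
Lemma dist_ends_sum (R : numDomainType) (k : nat) (g : 'I_k.+1 -> R) :
    (forall l : 'I_k, g (step_start l) <= g (step_end l)) ->
  `|g ord0 - g ord_max| = \sum_(l < k) `|g (step_start l) - g (step_end l)|.
Proof.
move=> g_le.
under eq_bigr => l _ do rewrite distrC ger0_norm ?subr_ge0 //.
rewrite telescope_steps distrC ger0_norm // -telescope_steps.
by apply: sumr_ge0 => l _; rewrite subr_ge0.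
Qed.

Lemma sorted_enumeration (d : Order.disp_t) (T : orderType d) (X : finType)
    (f : X -> T) :
  exists2 x : 'I_#|X| -> X, bijective x &
    forall a b : 'I_#|X|, (a <= b)%N -> (f (x a) <= f (x b))%O.
Proof.
pose r : rel X := relpre f <=%O.
have r_total : total r by move=> a b; apply: le_total.
have r_trans : transitive r by move=> b a c; apply: le_trans.
pose s := [tuple of sort r (enum_tuple X)].
have s_uniq : uniq s by rewrite sort_uniq enum_uniq.
exists (tnth s).
  by apply: inj_card_bij; [apply/tuple_uniqP | rewrite card_ord].
move=> a b le_ab; rewrite !(tnth_nth (tnth_default s a)).
apply: (sorted_leq_nth r_trans _ _ (sort_sorted r_total _)) => //.
- by move=> c; apply: lexx.
- by rewrite inE size_tuple.
- by rewrite inE size_tuple.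
Qed.

(** Strict majorization and equivalence are the two cases of a single statement,
    an inequality together with its equality condition: the sums of the steps
    are equal exactly when all the matched steps are. *)
Lemma sum_majorization (R : realDomainType) (d : Order.disp_t) (L : bOrderType d)
    (X : Type) (delta : X -> X -> L) (f : X -> R) (n k : nat) (x : 'I_n -> X)
    (i j : 'I_k.+1 -> 'I_n) (pi : 'S_k)
    (f_lt : forall x y z w, (delta x y < delta z w)%O <->
                            `|f x - f y| < `|f z - f w|)
    (f_eq : forall x y z w, delta x y = delta z w <->
                            `|f x - f y| = `|f z - f w|)
    (x_mono : forall a b : 'I_n, (a <= b)%N -> f (x a) <= f (x b)) :
    monotone_seq i -> monotone_seq j ->
    (forall l, (step_dist delta x i l <= step_dist delta x j (pi l))%O) ->
  `|f (x (i ord0)) - f (x (i ord_max))| <=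
     `|f (x (j ord0)) - f (x (j ord_max))|
     ?= iff [forall l, step_dist delta x i l == step_dist delta x j (pi l)].
Proof.
move=> i_mono j_mono le_ij.
rewrite (dist_ends_sum (g := fun l => f (x (i l)))); last first.
  by move=> l; apply/x_mono/i_mono.
rewrite (dist_ends_sum (g := fun l => f (x (j l)))); last first.
  by move=> l; apply/x_mono/j_mono.
rewrite [X in _ <= X ?= iff _](reindex_inj (@perm_inj _ pi)).
apply: leif_sum => l _; split.
- by rewrite leNgt; apply/negP => /f_lt; apply/negP; rewrite -leNgt; apply: le_ij.
- by apply/eqP/eqP => /f_eq.
Qed.

Theorem proposition7p3 (R : realType) (d : Order.disp_t) (L : bOrderType d)
    (X : finType) (delta : X -> X -> L) (n : nat) (n_gt0 : (0 < n)%N)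
    (cardX : #|X| = n) (delta_ordinal : ordinal_space delta)
    (X_embeds : embeddable R 1 delta) :
  exists x : 'I_n -> X, bijective x /\ majorization_property delta x.
Proof.
case: X_embeds => Phi PhiP; pose f a := Phi a 0 0.
have f_lt a b c e : (delta a b < delta c e)%O <-> `|f a - f b| < `|f c - f e|.
  by case: (PhiP a b c e); rewrite !euclidean_dist1.
have f_eq a b c e : delta a b = delta c e <-> `|f a - f b| = `|f c - f e|.
  by case: (PhiP a b c e); rewrite !euclidean_dist1.
case: n / cardX n_gt0 => _.
have [x x_bij x_mono] := sorted_enumeration f.
exists x; split=> // k i j _ i_mono j_mono; split=> -[pi].
- case=> le_ij ne_ij; apply/f_lt.
  rewrite (lt_leif (sum_majorization f_lt f_eq x_mono i_mono j_mono le_ij)).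
  by apply/forallP => eq_ij; apply: ne_ij => l; apply/eqP.
- move=> eq_ij; apply/f_eq/eqP.
  have le_ij l : (step_dist delta x i l <= step_dist delta x j (pi l))%O.
    by rewrite eq_ij.
  rewrite (eq_leif (sum_majorization f_lt f_eq x_mono i_mono j_mono le_ij)).
  by apply/forallP => l; rewrite eq_ij.
Qed.
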